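(* As formal power series in $u$, $$\sum_{n\ge0}S_n^B(q)\frac{u^n}{B_n(1,q)}=\frac{\cos_q(u)\cos_B(u;q)+(\sin_q(u)+1)\sin_B(u;q)}{\cos_q(u)}.$$
   Context: $\mathfrak{B}_n$ is the group of permutations $w$ of $\{\pm1,\dots,\pm n\}$ with $w(-i)=-w(i)$; write $w_i=w(i)$. The type B inversion number is $$\mathrm{inv}_B(w)=|\{1\le i<j\le n:w_i>w_j\}|+|\{1\le i<j\le n:-w_i>w_j\}|+|\{1\le i\le n:w_i<0\}|,$$ and $B_n(1,q)=\sum_{w\in\mathfrak{B}_n}q^{\mathrm{inv}_B(w)}$. A snake in $\mathfrak{B}_n$ is $w\in\mathfrak{B}_n$ with $0<w_1>w_2<w_3>\cdots$ (alternating up to $w_n$). $S_n^B(q)=\sum_{w}q^{\mathrm{inv}_B(w)}$, the sum over all snakes $w$ in $\mathfrak{B}_n$; $S_0^B(q)=B_0(1,q)=1$. $[j]_q=1+q+\cdots+q^{j-1}$, $[n]_q!=\prod_{j=1}^n[j]_q$, $\mathrm{e}_q(u)=\sum_{n\ge0}u^n/[n]_q!$, $\exp_B(u;q)=\sum_{n\ge0}u^n/B_n(1,q)$, and with $i^2=-1$: $\cos_q(u)=\frac{\mathrm{e}_q(iu)+\mathrm{e}_q(-iu)}2$, $\sin_q(u)=\frac{\mathrm{e}_q(iu)-\mathrm{e}_q(-iu)}{2i}$, $\cos_B(u;q)=\frac{\exp_B(iu;q)+\exp_B(-iu;q)}2$, $\sin_B(u;q)=\frac{\exp_B(iu;q)-\exp_B(-iu;q)}{2i}$.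 *)

(* Defs.v *)
(* Mathematical Components; boolp is used for extensionality of power series. *)
From HB Require Import structures.
From mathcomp Require Import all_boot all_order all_fingroup all_algebra.
From mathcomp Require Import boolp.

Set Implicit Arguments.
Unset Strict Implicit.
Unset Printing Implicit Defensive.

Import Order.TTheory GRing.Theory Num.Theory.
Local Open Scope ring_scope.

(* Formal power series in one variable u, given by their coefficients. *)
Record fps (R : Type) := FPS { coefs :> nat -> R }.

Lemma fpsP (R : Type) (f g : fps R) : f =1 g -> f = g.
Proof. by case: f g => [f] [g] /= fg; congr FPS; apply/funext. Qed.

HB.instance Definition _ (R : Type) := gen_eqMixin (fps R).
HB.instance Definition _ (R : Type) := gen_choiceMixin (fps R).

Section FpsZmodule.
Variable R : zmodType.
Implicit Types f g : fps R.

Definition fps_zero : fps R := FPS (fun=> 0).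
Definition fps_add f g : fps R := FPS (fun n => f n + g n).
Definition fps_opp f : fps R := FPS (fun n => - f n).

Fact fps_addA : associative fps_add.
Proof. by move=> f g h; apply: fpsP => n /=; rewrite addrA. Qed.
Fact fps_addC : commutative fps_add.
Proof. by move=> f g; apply: fpsP => n /=; rewrite addrC. Qed.
Fact fps_add0 : left_id fps_zero fps_add.
Proof. by move=> f; apply: fpsP => n /=; rewrite add0r. Qed.
Fact fps_addN : left_inverse fps_zero fps_opp fps_add.
Proof. by move=> f; apply: fpsP => n /=; rewrite addNr. Qed.

HB.instance Definition _ := GRing.isZmodule.Build (fps R)
  fps_addA fps_addC fps_add0 fps_addN.
End FpsZmodule.

Definition fpsC (R : nzRingType) (c : R) : fps R :=
  FPS (fun n => c *+ (n == 0%N)).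

Section FpsRing.
Variable R : comNzRingType.
Implicit Types f g h : fps R.

Definition fps_mul f g : fps R :=
  FPS (fun n => \sum_(i < n.+1) f i * g (n - i)%N).

Let trunc N f : {poly R} := \poly_(i < N.+1) f i.

Let coef_trunc N f i : (i <= N)%N -> (trunc N f)`_i = f i.
Proof. by move=> iN; rewrite coef_poly ltnS iN. Qed.

Let fps_mulE N f g n : (n <= N)%N ->
  fps_mul f g n = (trunc N f * trunc N g)`_n.
Proof.
move=> nN; rewrite coefM; apply: eq_bigr => i _.
rewrite !coef_trunc //; first by rewrite (leq_trans (leq_subr _ _)).
by apply: leq_trans nN; rewrite -ltnS.
Qed.

Fact fps_mulA : associative fps_mul.
Proof.
move=> f g h; apply: fpsP => n.
transitivity (trunc n f * trunc n g * trunc n h)`_n; last first.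
  rewrite coefM; apply: eq_bigr => i _.
  by rewrite -fps_mulE ?coef_trunc ?leq_subr // -ltnS.
rewrite -mulrA coefM; apply: eq_bigr => i _.
by rewrite -fps_mulE ?leq_subr // coef_trunc // -ltnS.
Qed.

Fact fps_mulC : commutative fps_mul.
Proof. by move=> f g; apply: fpsP => n; rewrite !(fps_mulE _ _ (leqnn n)) mulrC. Qed.

Fact fps_mul1 : left_id (fpsC 1) fps_mul.
Proof.
move=> f; apply: fpsP => n /=.
rewrite big_ord_recl /= mul1r subn0 big1 ?addr0 // => i _.
by rewrite /= mulr0n mul0r.
Qed.

Fact fps_mulDl : left_distributive fps_mul +%R.
Proof.
move=> f g h; apply: fpsP => n /=; rewrite -big_split /=.
by apply: eq_bigr => i _; rewrite mulrDl.
Qed.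

Fact fps_1neq0 : fpsC (1 : R) != 0.
Proof.
by apply/eqP => /(congr1 (fun f : fps R => f 0%N)) /eqP; rewrite oner_eq0.
Qed.

HB.instance Definition _ := GRing.Zmodule_isComNzRing.Build (fps R)
  fps_mulA fps_mulC fps_mul1 fps_mulDl fps_1neq0.
End FpsRing.

(* A power series is invertible iff its constant coefficient is; the first n  *)
(* coefficients of the inverse are computed recursively.                      *)
Section FpsUnitRing.
Variable R : comUnitRingType.
Implicit Types f g : fps R.

Definition fps_unit : pred (fps R) := fun f => f 0%N \is a GRing.unit.

Fixpoint fps_inv_seq f n : seq R :=
  if n is m.+1 then
    let s := fps_inv_seq f m in
    rcons s (((m == 0%N)%:R - \sum_(i < m) s`_i * f (m - i)%N) / f 0%N)
  else [::].

Definition fps_inv f : fps R :=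
  if fps_unit f then FPS (fun n => (fps_inv_seq f n.+1)`_n) else f.

Let size_inv f n : size (fps_inv_seq f n) = n.
Proof. by elim: n => //= n IHn; rewrite size_rcons IHn. Qed.

Let nth_inv f n i : (i < n)%N ->
  (fps_inv_seq f n)`_i = (fps_inv_seq f i.+1)`_i.
Proof.
elim: n => // n IHn; rewrite ltnS leq_eqVlt => /orP[/eqP -> // | lt_in].
by rewrite [in LHS]/= nth_rcons size_inv lt_in IHn.
Qed.

Fact fps_mulV : {in fps_unit, left_inverse 1 fps_inv *%R}.
Proof.
move=> f uf; apply: fpsP => n.
have {}uf : fps_unit f := uf.
rewrite /fps_inv uf /= big_ord_recr /= subnn nth_rcons size_inv ltnn eqxx.
rewrite divrK //.
under eq_bigr => i _ do rewrite -/(fps_inv_seq f i.+1) -(nth_inv f (ltn_ord i)).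
by rewrite addrC subrK.
Qed.

Fact fps_unitP f g : g * f = 1 -> fps_unit f.
Proof.
move=> /(congr1 (fun h : fps R => h 0%N)) /=.
rewrite big_ord1 subnn => gf1; apply/unitrPr; exists (g 0%N).
by rewrite mulrC.
Qed.

Fact fps_inv_out : {in [predC fps_unit], fps_inv =1 id}.
Proof. by move=> f; rewrite inE /fps_inv -topredE /= => /negbTE ->. Qed.

HB.instance Definition _ := GRing.ComNzRing_hasMulInverse.Build (fps R)
  fps_mulV fps_unitP fps_inv_out.
End FpsUnitRing.

(* The series f(c u). *)
Definition fps_scale (R : nzRingType) (c : R) (f : fps R) : fps R :=
  FPS (fun n => c ^+ n * f n).

(* The letters {+-1, ..., +-n}: the pair (s, i) encodes +(i+1) when s is      *)
(* false and -(i+1) when s is true.                                           *)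
Definition letter (n : nat) : finType := (bool * 'I_n)%type.

Definition letter_val n (x : letter n) : int :=
  if x.1 then - (x.2.+1)%:Z else (x.2.+1)%:Z.

Definition letter_opp n (x : letter n) : letter n := (~~ x.1, x.2).

Definition signed_perms n : {set {perm letter n}} :=
  [set w : {perm letter n} | [forall x, w (letter_opp x) == letter_opp (w x)]].

(* Indices are shifted by one: window w i is w_(i+1). *)
Definition window n (w : {perm letter n}) (i : 'I_n) : int :=
  letter_val (w (false, i)).

Definition invB n (w : {perm letter n}) : nat :=
  (#|[set p : 'I_n * 'I_n | (p.1 < p.2)%N && (window w p.1 > window w p.2)%R]|
   + #|[set p : 'I_n * 'I_n | (p.1 < p.2)%N && (- window w p.1 > window w p.2)%R]|
   + #|[set i : 'I_n | (window w i < 0)%R]|)%N.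

(* Owing to the index shift, the descents w_1 > w_2, w_3 > w_4, ... sit at    *)
(* even positions i.                                                          *)
Definition snake n (w : {perm letter n}) : bool :=
  [forall i : 'I_n, (i == 0 :> nat) ==> (0 < window w i)]
  && [forall i : 'I_n, forall j : 'I_n, (j == i.+1 :> nat) ==>
        (if odd i then window w i < window w j else window w i > window w j)].

Section Series.
Variables (K : fieldType) (q : K).

Definition Bpoly (n : nat) : K := \sum_(w in signed_perms n) q ^+ invB w.

Definition Spoly (n : nat) : K :=
  \sum_(w in signed_perms n | snake w) q ^+ invB w.

Definition qint (j : nat) : K := \sum_(k < j) q ^+ k.
Definition qfact (n : nat) : K := \prod_(1 <= j < n.+1) qint j.

Definition exp_q : fps K := FPS (fun n => (qfact n)^-1).
Definition exp_B : fps K := FPS (fun n => (Bpoly n)^-1).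

(* Cosine and sine parts of a series, for i a square root of -1. *)
Definition cos_of (i : K) (f : fps K) : fps K :=
  (fps_scale i f + fps_scale (- i) f) / fpsC 2.
Definition sin_of (i : K) (f : fps K) : fps K :=
  (fps_scale i f - fps_scale (- i) f) / fpsC (2 * i).
End Series.

(* The field C(q) of rational functions, its indeterminate q and the          *)
(* imaginary unit.                                                            *)
Definition ratfun (C : numClosedFieldType) : fieldType := {fraction {poly C}}.
Definition qvar (C : numClosedFieldType) : ratfun C := tofrac 'X.
Definition imag (C : numClosedFieldType) : ratfun C := tofrac ('i : C)%:P.

(* Main.v *)
Require Import Defs.
From mathcomp Require Import all_boot all_order all_fingroup all_algebra.
From mathcomp Require Import boolp zify ring.

(** Write S_k and B_k for the generating polynomials of snakes and of all
    signed permutations, so that multiplying a series in u^k / B_k by a series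
    in u^m / [m]_q! produces the numbers S_k B_n / (B_k [n-k]_q!).  Such a
    number is the generating polynomial E(n,k) of the signed permutations w of
    size n in which w_1 ... w_k is a snake and w_(k+1) < ... < w_n.  Two facts
    give this:

    - appending a letter to a signed permutation of size n, in all the 2(n+1)
      possible ways, multiplies the generating polynomial of any property of
      the relative order by [2n+2]_q (gf_append), so that the permutations of
      size n whose first k letters form a snake contribute S_k B_n / B_k
      (gf_snake_extend);

    - as in bubble sort, sorting the letters in positions k+1, ..., n by
      adjacent transpositions, each of which changes inv_B by 1, divides out
      the factor [n-k]_q! (gf_incr_on).

    For k odd the last snake step is w_(k-1) < w_k, hence comparing w_k with
    w_(k+1) splits E(n,k) as F(n,k-1) + F(n,k+1), where F(n,k) asks for a snake
    w_1 ... w_k with w_k < w_(k+1) < ... < w_n (gf_snake_split).  The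
    alternating sum of E(n,k) over odd k therefore telescopes, with F(n,0) = 1
    at one end and, at the other, S_n for n even and nothing for n odd.  Read
    on coefficients, these two cases are

      S_odd cos_q = sin_B   and   S_even = S_odd sin_q + cos_B

    (odd_part_cos, even_part_sin_cos), and the theorem follows by adding
    cos_q times the second identity to the first.

    Signed permutations are handled as words w : nat -> int with w 0 = 0 and
    letters w 1, ..., w n.  With w 0 = 0 the condition 0 < w_1 becomes an
    ordinary ascent at position 0. *)

Set Implicit Arguments.
Unset Strict Implicit.
Unset Printing Implicit Defensive.
Import Order.TTheory GRing.Theory Num.Theory.
Local Open Scope ring_scope.

(** * Inversions and snakes of words of integers *)

(** The inversions created by the letter in position j+1, so that appending a
    letter to a word only adds one term to [signed_inv]. *)
Definition row_inv (f : nat -> int) (j : nat) : nat :=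
  (\sum_(i < j) ((f j.+1 < f i.+1)%R + (f j.+1 < - f i.+1)%R)
   + (f j.+1 < 0)%R)%N.

Definition signed_inv (n : nat) (f : nat -> int) : nat := (\sum_(j < n) row_inv f j)%N.

Definition snake_upto (k : nat) (f : nat -> int) : Prop :=
  forall i, (i < k)%N -> if odd i then f i.+1 < f i else f i < f i.+1.

Definition incr_on (k n : nat) (f : nat -> int) : Prop :=
  forall i, (k <= i < n)%N -> f i < f i.+1.

(** Renaming letters by such a map keeps the relative order of the numbers
    0, +-w_1, ..., +-w_n, hence all the statistics considered here. *)
Definition odd_increasing (h : int -> int) : Prop :=
  {morph h : x / - x} /\ {mono h : x y / x < y}.

Lemma odd_increasing0 h : odd_increasing h -> h 0 = 0.
Proof. by case=> hN _; have := hN 0; rewrite oppr0; move: (h 0) => x; lia. Qed.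

Lemma signed_inv_odd_increasing n h f g : odd_increasing h ->
  (forall i, (i <= n)%N -> g i = h (f i)) -> signed_inv n g = signed_inv n f.
Proof.
move=> ho gf; have h0 := odd_increasing0 ho; case: ho => hN hlt.
apply: eq_bigr => j _; rewrite /row_inv.
rewrite gf ?ltn_ord //; congr (_ + _)%N; last by rewrite -{1}h0 hlt.
apply: eq_bigr => i _; rewrite gf; last by have := ltn_ord i; have := ltn_ord j; lia.
by rewrite -hN !hlt.
Qed.

Lemma snake_odd_increasing k h f g : odd_increasing h ->
  (forall i, (i <= k)%N -> g i = h (f i)) -> snake_upto k g <-> snake_upto k f.
Proof.
move=> [_ hlt] gf; split=> sn i ik; have := sn i ik; rewrite !gf ?hlt //; exact: ltnW.
Qed.

Definition swap_at (j k : nat) : nat :=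
  if k == j then j.+1 else if k == j.+1 then j else k.

Lemma swap_atL j : swap_at j j = j.+1.
Proof. by rewrite /swap_at eqxx. Qed.

Lemma swap_atR j : swap_at j j.+1 = j.
Proof. by rewrite /swap_at eqxx gtn_eqF. Qed.

Lemma swap_atD j k : k != j -> k != j.+1 -> swap_at j k = k.
Proof. by rewrite /swap_at => /negPf -> /negPf ->. Qed.

Lemma swap_atS j k : swap_at j.+1 k.+1 = (swap_at j k).+1.
Proof. by rewrite /swap_at !eqSS; do !case: eqP. Qed.

Lemma swap_lt j k : (k < j)%N -> swap_at j k = k.
Proof. by move=> kj; rewrite swap_atD //; lia. Qed.

(** Precomposition with [swap_at j] is the action of an adjacent transposition
    on words; it leaves alone every sum over an initial segment of positions
    containing both j and j+1. *)
Lemma sum_swap j n (G : nat -> nat) : (j.+1 < n)%N ->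
  (\sum_(i < n) G (swap_at j i) = \sum_(i < n) G i)%N.
Proof.
elim: n => // n IHn; rewrite ltnS leq_eqVlt => /orP[/eqP <-|jn].
  rewrite !big_ord_recr /= swap_atL swap_atR -!addnA [(G j.+1 + _)%N]addnC.
  by congr (_ + _)%N; apply: eq_bigr => i _; rewrite swap_lt.
by rewrite !big_ord_recr /= IHn // swap_atD //; lia.
Qed.

Lemma row_inv_swap j f k : k != j -> k != j.+1 ->
  row_inv (f \o swap_at j.+1) k = row_inv f k.
Proof.
move=> kj kj1; rewrite /row_inv /= swap_atS swap_atD //; congr (_ + _)%N.
under eq_bigr do rewrite swap_atS.
case: (ltnP j.+1 k) => [jk|kj'].
  exact: (sum_swap (fun i => (f k.+1 < f i.+1)%R + (f k.+1 < - f i.+1)%R)%N jk).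
by apply: eq_bigr => i _; rewrite swap_lt //; have := ltn_ord i; lia.
Qed.

(** Among the pairs counted by inv_B, exchanging neighbours only alters the
    comparison of w_(j+1) with w_(j+2): the condition - w_i > w_j is symmetric
    in i and j, and the other terms are permuted. *)
Lemma signed_inv_swap j n f : (j.+1 < n)%N -> f j.+1 < f j.+2 ->
  signed_inv n (f \o swap_at j.+1) = (signed_inv n f).+1.
Proof.
elim: n => // n IHn; rewrite ltnS leq_eqVlt => /orP[/eqP <- lt12|jn lt12]; last first.
  by rewrite /signed_inv !big_ord_recr /= -!/(signed_inv _ _) IHn // row_inv_swap //; lia.
rewrite /signed_inv !big_ord_recr /=.
have -> : (\sum_(i < j) row_inv (f \o swap_at j.+1) i = \sum_(i < j) row_inv f i)%N.
  by apply: eq_bigr => i _; rewrite row_inv_swap //; have := ltn_ord i; lia.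
rewrite -!addnA -addnS; congr (_ + _)%N.
rewrite /row_inv big_ord_recr [in RHS]big_ord_recr /= !swap_atS swap_atL swap_atR.
have S x : (\sum_(i < j) ((x < f (swap_at j.+1 i.+1))%R + (x < - f (swap_at j.+1 i.+1))%R)
           = \sum_(i < j) ((x < f i.+1)%R + (x < - f i.+1)%R))%N.
  by apply: eq_bigr => i _; rewrite swap_atS swap_lt.
have -> : (f j.+1 < - f j.+2) = (f j.+2 < - f j.+1) by lia.
have -> : (f j.+2 < f j.+1) = false by lia.
rewrite !S lt12.
move: (\sum_(i < j) _)%N (\sum_(i < j) _)%N (f _ < 0) (f _ < 0) (_ < - _) => A B [] [] []; lia.
Qed.

(** * Signed permutations as words *)

(** Absolute values and signs; this splitting makes the operations of appending
    a letter and of exchanging positions instances of [lift_perm] and [tperm]. *)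
Definition signed_word (n : nat) : finType := ('S_n * {ffun 'I_n -> bool})%type.

Definition entry (n : nat) (w : signed_word n) (k : nat) : int :=
  if k is k'.+1 then
    if insub k' is Some i then letter_val (w.2 i, w.1 i) else 0
  else 0.

Lemma entryE n (w : signed_word n) (i : 'I_n) :
  entry w i.+1 = letter_val (w.2 i, w.1 i).
Proof. by rewrite /= valK. Qed.

Lemma entryP n (w : signed_word n) k : (0 < k <= n)%N ->
  exists2 i : 'I_n, k = i.+1 & entry w k = letter_val (w.2 i, w.1 i).
Proof.
by case: k => // k kn; exists (Ordinal kn) => //; rewrite -entryE.
Qed.

Lemma entry_inj n (w : signed_word n) j k :
  (0 < j <= n)%N -> (0 < k <= n)%N -> entry w j = entry w k -> j = k.
Proof.
move=> /(entryP w)[i -> ->] /(entryP w)[i' -> ->] eii'.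
have : w.1 i = w.1 i'.
  apply: val_inj; move: eii'; rewrite /letter_val /=.
  by case: (w.2 i); case: (w.2 i') => /=; lia.
by move/perm_inj=> ->.
Qed.

Lemma entry_bound n (w : signed_word n) k : entry w k <= n%:Z.
Proof.
case: k => // k; rewrite /=; case: insubP => // i _ _; rewrite /letter_val /=.
by have := ltn_ord (w.1 i); case: (w.2 i) => /=; lia.
Qed.

Definition swap_word n (w : signed_word n) (i j : 'I_n) : signed_word n :=
  ((tperm i j * w.1)%g, [ffun k => w.2 (tperm i j k)]).

Lemma swap_wordK n i j : involutive (fun w : signed_word n => swap_word w i j).
Proof.
case=> s e; rewrite /swap_word /= mulgA tperm2 mul1g; congr (_, _).
by apply/ffunP => k; rewrite !ffunE tpermK.
Qed.

Lemma entry_swap n (w : signed_word n) (i j : 'I_n) k : j = i.+1 :> nat ->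
  entry (swap_word w i j) k = entry w (swap_at i.+1 k).
Proof.
move=> ji; case: k => [//|k]; rewrite swap_atS.
case: (ltnP k n) => [kn|nk]; last first.
  rewrite swap_atD; first by rewrite /= !insubF //; apply/negbTE; rewrite -leqNgt.
    by have := ltn_ord i; lia.
  by have := ltn_ord j; lia.
rewrite (entryE (swap_word w i j) (Ordinal kn)) /= permM ffunE.
rewrite -(entryE _ (tperm i j (Ordinal kn))).
congr (entry w _.+1); rewrite /swap_at;
  case: tpermP => [/(congr1 val) /= ->|/(congr1 val) /= ->|] /=.
- by rewrite !eqxx ji.
- by rewrite -ji eqxx; case: eqP => //; lia.
by move=> /eqP + /eqP; rewrite -!val_eqE /= -ji => /negPf-> /negPf->.
Qed.

(** Makes room for the letters +-(c+1) by moving away from 0 the numbers of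
    absolute value larger than c. *)
Definition open_gap (c : nat) (z : int) : int :=
  if c%:Z < z then z + 1 else if z < - c%:Z then z - 1 else z.

Lemma open_gap_odd_increasing c : odd_increasing (open_gap c).
Proof.
by split=> [x|x y]; rewrite /open_gap; do !case: ifP => ?; lia.
Qed.

Definition append_letter n (w : signed_word n) (x : letter n.+1) :
  signed_word n.+1 :=
  (lift_perm ord_max x.2 w.1,
   [ffun i => if unlift ord_max i is Some j then w.2 j else x.1]).

Lemma entry_append_last n (w : signed_word n) x :
  entry (append_letter w x) n.+1 = letter_val x.
Proof.
by rewrite (entryE _ ord_max) /= ffunE unlift_none lift_perm_id; case: x.
Qed.

Lemma letter_val_lift n b (c : 'I_n.+1) (i : 'I_n) :
  letter_val (b, lift c i) = open_gap c (letter_val (b, i)).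
Proof.
rewrite /letter_val /open_gap /= /bump; case: (leqP c i) => ci; case: b => /=;
  by do !case: ifP => ?; lia.
Qed.

Lemma entry_append n (w : signed_word n) x k : (k <= n)%N ->
  entry (append_letter w x) k = open_gap x.2 (entry w k).
Proof.
case: k => [|k] kn; first by rewrite (odd_increasing0 (open_gap_odd_increasing _)).
have [i ->] : exists i : 'I_n, k = i by exists (Ordinal kn).
by rewrite entryE -letter_val_lift -lift_max entryE /= ffunE liftK lift_perm_lift.
Qed.

Lemma append_letter_inj n :
  injective (fun p : signed_word n * letter n.+1 => append_letter p.1 p.2).
Proof.
move=> [[s e] [b c]] [[s' e'] [b' c']] [] /= /permP es /ffunP ee.
have ec : c = c' by have := es ord_max; rewrite !lift_perm_id.
have eb : b = b' by have := ee ord_max; rewrite !ffunE unlift_none.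
rewrite {}ec in es *; rewrite {}eb in ee *; congr (_, _, _).
  apply/permP => i; have := es (lift ord_max i).
  by rewrite !lift_perm_lift => /lift_inj.
by apply/ffunP => i; have := ee (lift ord_max i); rewrite !ffunE liftK.
Qed.

Lemma card_signed_word n : #|{: signed_word n}| = (n`! * 2 ^ n)%N.
Proof. by rewrite card_prod card_Sn card_ffun card_bool card_ord. Qed.

(** Both sides have (n+1)! 2^(n+1) elements, so injectivity is enough. *)
Lemma append_letter_bij n :
  bijective (fun p : signed_word n * letter n.+1 => append_letter p.1 p.2).
Proof.
apply: (inj_card_bij (@append_letter_inj n)).
have -> : #|{: signed_word n * letter n.+1}| = (n`! * 2 ^ n * (2 * n.+1))%N.
  by rewrite card_prod (card_signed_word n) [in X in (_ * X)%N]card_prod card_bool card_ord.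
by rewrite (card_signed_word n.+1) factS expnS; apply/eq_leq; lia.
Qed.

(** The last letter +-(c+1) faces each other letter y through the pair of
    comparisons with y and -y, hence only through |y|.  The absolute values of
    the others are all the numbers up to n+1 except c+1.  A positive last letter
    gets 1 from each one larger than c+1; a negative one gets 1 from each larger
    one, 2 from each smaller one, and 1 from its own sign. *)
Lemma row_inv_append n (w : signed_word n) (x : letter n.+1) :
  row_inv (entry (append_letter w x)) n = (if x.1 then n.+1 + x.2 else n - x.2)%N.
Proof.
case: x => b c; rewrite /row_inv entry_append_last.
have E (i : 'I_n) : entry (append_letter w (b, c)) i.+1 = letter_val (w.2 i, lift c (w.1 i)).
  by rewrite entry_append // (entryE w i) letter_val_lift.
pose g (i : nat) : nat := if b then (1 + (i < c))%N else (c <= i)%N.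
(* g m is the contribution of a letter whose absolute value was m+1. *)
rewrite (eq_bigr (fun i : 'I_n => g (w.1 i))); last first.
  move=> i _; rewrite E /g /letter_val /= /bump.
  move: (nat_of_ord (w.1 i)) (nat_of_ord c) => m d.
  by case: (leqP d m) => dm; case: (b); case: (w.2 i) => /=;
    rewrite ?opprK ?ltrN2 ?ltz_nat; lia.
have -> : (\sum_(i < n) g (w.1 i) = \sum_(i < n) g i)%N.
  by rewrite [RHS](reindex_inj (@perm_inj _ w.1)).
have : (c <= n)%N by rewrite -ltnS.
rewrite {}/g /letter_val /=; move: (c : nat) => {E} {}c cn; case: b.
  rewrite big_split /= sum1_card card_ord.
  have -> : (\sum_(i < n) (i < c) = minn n c)%N; last by lia.
  by elim: n {w cn} => [|n IHn]; rewrite ?big_ord0 ?big_ord_recr /= ?IHn; lia.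
have -> : (\sum_(i < n) (c <= i) = n - c)%N; last by lia.
by elim: n {w cn} => [|n IHn]; rewrite ?big_ord0 ?big_ord_recr /= ?IHn; lia.
Qed.

(** * Generating polynomials *)

Section GeneratingFunctions.
Variables (K : fieldType) (q : K).

Definition gf (n : nat) (P : (nat -> int) -> Prop) : K :=
  \sum_(w : signed_word n | `[< P (entry w) >]) q ^+ signed_inv n (entry w).

Lemma eq_gf n P Q :
  (forall w : signed_word n, P (entry w) <-> Q (entry w)) -> gf n P = gf n Q.
Proof. by move=> PQ; apply: eq_bigl => w; apply: asbool_equiv_eq. Qed.

Lemma gf_split n P Q :
  gf n P = gf n (fun f => P f /\ Q f) + gf n (fun f => P f /\ ~ Q f).
Proof.
rewrite /gf (bigID (fun w : signed_word n => `[< Q (entry w) >])) /=.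
congr (_ + _); apply: eq_bigl => w; rewrite ?asbool_and ?asbool_neg //.
Qed.

(** The numbers of inversions contributed by the 2(n+1) possible last letters
    are 0, ..., 2n+1, each once: 0, ..., n from the positive letters, the rest
    from the negative ones. *)
Lemma qint_signed n :
  \sum_(x : letter n.+1) q ^+ (if x.1 then n.+1 + x.2 else n - x.2)%N
  = qint q n.+1.*2.
Proof.
rewrite -addnn /qint big_split_ord /=.
rewrite -(pair_bigA _
  (fun (b : bool) (c : 'I_n.+1) => q ^+ (if b then n.+1 + c else n - c)%N)) /=.
rewrite big_bool /= addrC; congr (_ + _).
rewrite (reindex_inj rev_ord_inj); apply: eq_bigr => i _ /=; congr (_ ^+ _).
by have := ltn_ord i; lia.
Qed.

(** A property of the relative order of the first n letters is not affected by
    the choice of the last one, whose contribution to inv_B factors out. *)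
Lemma gf_append n P :
  (forall f g h, odd_increasing h ->
     (forall i, (i <= n)%N -> g i = h (f i)) -> P g <-> P f) ->
  gf n.+1 P = qint q n.+1.*2 * gf n P.
Proof.
move=> Pinv; rewrite /gf -qint_signed mulrC mulr_sumr.
rewrite (reindex (fun p : signed_word n * letter n.+1 => append_letter p.1 p.2)) /=; last first.
  exact/onW_bij/append_letter_bij.
under [RHS]eq_bigr do rewrite mulr_suml.
rewrite exchange_big /= pair_big_dep /=.
apply: eq_big => [[w x]|[w x] _] /=; rewrite ?andbT.
  apply: asbool_equiv_eq; apply: (Pinv _ _ (open_gap x.2)) => [|i ni].
    exact: open_gap_odd_increasing.
  exact: entry_append.
rewrite /signed_inv big_ord_recr /= -!/(signed_inv _ _) row_inv_append exprD; congr (q ^+ _ * _).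
apply: (signed_inv_odd_increasing (open_gap_odd_increasing x.2)) => i ni.
exact: entry_append.
Qed.

(** If P forces a descent at a given place, undoing this descent loses exactly
    one inversion. *)
Lemma gf_swap n j P : (j.+1 < n)%N ->
  (forall w : signed_word n, P (entry w) -> entry w j.+2 < entry w j.+1) ->
  gf n P = q * gf n (fun f => P (f \o swap_at j.+1)).
Proof.
move=> jn Pdes; pose i0 : 'I_n := Ordinal (ltnW jn); pose i1 : 'I_n := Ordinal jn.
have E (w : signed_word n) : entry (swap_word w i0 i1) = entry w \o swap_at j.+1.
  by apply/funext => k /=; apply: (@entry_swap _ w i0 i1).
rewrite /gf (reindex_inj (can_inj (@swap_wordK n i0 i1))) /= mulr_sumr.
apply: eq_big => [w|w]; rewrite E // => /asboolP Pw.
have := Pdes (swap_word w i0 i1); rewrite E /= swap_atL swap_atR => /(_ Pw) lt12.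
by rewrite signed_inv_swap // exprS.
Qed.

Definition sorted_block (k m : nat) (f : nat -> int) : Prop :=
  forall a b, (k < a < b)%N -> (b <= k + m)%N -> f a < f b.

(** The block k+1, ..., k+m is sorted apart from its entry at k+i, which is only
    known to be smaller than the entries to its right.  These are the stages of
    the insertion of the last entry of a block into the sorted rest: it is free
    for i = m, and i = 1 means that the whole block is sorted. *)
Definition sorted_block_but (k m i : nat) (f : nat -> int) : Prop :=
  forall a b, (k < a < b)%N -> (b <= k + m)%N -> b != (k + i)%N -> f a < f b.

Definition prefix_property (k : nat) (P : (nat -> int) -> Prop) : Prop :=
  forall f g, (forall a, (a <= k)%N -> f a = g a) -> P f -> P g.

(** One step of the insertion: if the moving entry is smaller than its left
    neighbour, exchanging the two moves it one place to the left. *)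
Lemma sorted_block_swap n k m i (w : signed_word n) :
  (0 < i < m)%N -> (k + m <= n)%N ->
  let g := entry w \o swap_at (k + i)%N in
  sorted_block_but k m i.+1 g /\ ~ (g (k + i)%N < g (k + i).+1)
  <-> sorted_block_but k m i (entry w).
Proof.
move=> im kmn g; set f := entry w.
have gL : g (k + i)%N = f (k + i).+1 by rewrite /g /= swap_atL.
have gR : g (k + i).+1 = f (k + i)%N by rewrite /g /= swap_atR.
have gD a : a != (k + i)%N -> a != (k + i).+1 -> g a = f a.
  by move=> ? ?; rewrite /g /= swap_atD.
have f_inj : f (k + i)%N <> f (k + i).+1.
  by move=> /entry_inj; lia.
split=> [[bg ng] a b ab bm bi|bf]; last split.
- have [eb|nb] := eqVneq b (k + i).+1; have [ea|na] := eqVneq a (k + i)%N.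
  + by rewrite ea eb -gL -gR; move: ng f_inj; rewrite gL gR; lia.
  + by rewrite eb -gL -(gD a) //; [apply: bg|]; lia.
  + by rewrite ea -gR -(gD b) //; apply: bg; lia.
  have [ea'|na'] := eqVneq a (k + i).+1.
    by rewrite ea' -gL -(gD b) //; apply: bg; lia.
  by rewrite -(gD a) // -(gD b) //; apply: bg; lia.
- move=> a b ab bm bi.
  have [eb|nb] := eqVneq b (k + i)%N.
    by rewrite eb gL gD; [apply: bf| |]; lia.
  rewrite (gD b) //; last by lia.
  have [ea|na] := eqVneq a (k + i)%N.
    by rewrite ea gL; apply: bf; lia.
  have [ea'|na'] := eqVneq a (k + i).+1.
    by rewrite ea' gR; apply: bf; lia.
  by rewrite gD //; apply: bf; lia.
have := bf (k + i)%N (k + i).+1; rewrite gL gR; lia.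
Qed.

Lemma qintS j : qint q j.+1 = 1 + q * qint q j.
Proof.
rewrite /qint big_ord_recl expr0 mulr_sumr; congr (_ + _).
by apply: eq_bigr => i _; rewrite exprS.
Qed.

(** Either the moving entry is already in place, which is one occurrence of the
    sorted block, or an exchange, at the cost of a factor q, leads to the
    previous stage.  This is the recursion 1 + q [i]_q = [i+1]_q. *)
Lemma gf_sorted_block_but n k m i P : prefix_property k P ->
  (i < m)%N -> (k + m <= n)%N ->
  gf n (fun f => P f /\ sorted_block_but k m i.+1 f)
  = qint q i.+1 * gf n (fun f => P f /\ sorted_block k m f).
Proof.
move=> Pk + kmn; elim: i => [|i IHi] im.
  rewrite /qint big_ord1 expr0 mul1r; apply: eq_gf => w.
  split=> -[Pw bw]; split=> // a b ab bm; [apply: bw|move=> _; apply: bw]; lia.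
rewrite qintS mulrDl mul1r -mulrA -IHi; last exact: ltnW.
rewrite (gf_split _ _ (fun f => f (k + i.+1)%N < f (k + i.+1).+1)); congr (_ + _).
  apply: eq_gf => w; split=> [[[Pw bw] lw]|[Pw bw]]; last first.
    by split; [split=> // a b ab bm _|]; apply: bw; lia.
  split=> // a b ab bm; have [eb|nb] := eqVneq b (k + i.+2)%N; last exact: bw.
  have [->|na] := eqVneq a (k + i.+1)%N; first by rewrite eb [(k + i.+2)%N]addnS.
  apply: lt_trans (_ : entry w (k + i.+1)%N < _); first by apply: bw; lia.
  by rewrite eb [(k + i.+2)%N]addnS.
rewrite addnS (@gf_swap _ (k + i)); last 2 first.
- by lia.
- move=> w [_ /negP]; rewrite -leNgt le_eqVlt => /orP[/eqP/entry_inj|//].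
  by lia.
congr (_ * _); apply: eq_gf => w.
have [|Sto Sfrom] := @sorted_block_swap n k m i.+1 w _ kmn; first by lia.
have Pg : P (entry w \o swap_at (k + i.+1)) <-> P (entry w).
  by split; apply: Pk => a ak /=; rewrite swap_lt //; lia.
by rewrite !addnS in Pg Sto Sfrom *; tauto.
Qed.

(** Iterating the insertion, the m letters of a free block can be sorted at the
    cost of [1]_q [2]_q ... [m]_q. *)
Lemma gf_sorted_block n k m P : prefix_property k P -> (k + m <= n)%N ->
  gf n P = qfact q m * gf n (fun f => P f /\ sorted_block k m f).
Proof.
move=> Pk; elim: m => [|m IHm] kmn.
  rewrite /qfact big_nil mul1r; apply: eq_gf => w; split=> [Pw|[]//].
  by split=> // a b; lia.
rewrite IHm; last by lia.
rewrite [qfact q m.+1]big_nat_recr //= -/(qfact q m) -mulrA; congr (_ * _).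
rewrite -gf_sorted_block_but //; apply: eq_gf => w.
by split=> -[Pw bw]; split=> // a b ab bm; [move=> nb|]; apply: bw; lia.
Qed.

Lemma incr_on_lt k n f a b :
  incr_on k n f -> (k <= a < b)%N -> (b <= n)%N -> f a < f b.
Proof.
move=> inc; elim: b => [|b IHb]; first by lia.
move=> ab bn; have [->|nab] := eqVneq a b; first by apply: inc; lia.
by apply: (lt_trans (IHb _ _)); [| |apply: inc]; lia.
Qed.

Lemma gf_incr_on n k P : prefix_property k P -> (k <= n)%N ->
  gf n P = qfact q (n - k) * gf n (fun f => P f /\ incr_on k.+1 n f).
Proof.
move=> Pk kn; rewrite (@gf_sorted_block n k (n - k) P Pk); last by lia.
congr (_ * _); apply: eq_gf => w; split=> -[Pw bw]; split=> //.
  by move=> i ikn; apply: bw; lia.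
by move=> a b ab bn; apply: (incr_on_lt bw); lia.
Qed.

Lemma snake_prefix k : prefix_property k (snake_upto k).
Proof. by move=> f g fg sf i ik; have := sf i ik; rewrite !fg //; exact: ltnW. Qed.

(** The polynomial F(n,k); for k = 0 the word has to increase from w 0 = 0, so
    that all its letters are positive. *)
Definition snake_incr (n k : nat) : K :=
  gf n (fun f => snake_upto k f /\ incr_on k n f).

(** If w_k < w_(k+1), the tail can be started at w_(k-1) since w_(k-1) < w_k is
    the last step of a snake of odd length k; if w_k > w_(k+1), the snake
    extends to w_(k+1), after which the word increases. *)
Lemma gf_snake_split n k : odd k -> (k < n)%N ->
  gf n (fun f => snake_upto k f /\ incr_on k.+1 n f)
  = snake_incr n k.-1 + snake_incr n k.+1.
Proof.
case: k => // k /= ok kn; rewrite (gf_split _ _ (fun f => f k.+1 < f k.+2)).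
congr (_ + _); apply: eq_gf => w.
  split=> [[[sk inc] lt12]|[sk inc]].
    split=> i; first by move=> ik; apply: sk; lia.
    move=> ikn; have [->|n1] := eqVneq i k.
      by have := sk k; rewrite (negPf ok); apply.
    have [->//|n2] := eqVneq i k.+1.
    by apply: inc; lia.
  split; last by apply: inc; lia.
  split=> i; last by move=> ikn; apply: inc; lia.
  rewrite ltnS leq_eqVlt => /orP[/eqP ->|]; last exact: sk.
  by rewrite (negPf ok); apply: inc; lia.
split=> [[[sk inc] nlt]|[sk inc]].
  split=> // i; rewrite ltnS leq_eqVlt => /orP[/eqP ->|]; last exact: sk.
  rewrite /= ok; move/negP: nlt; rewrite -leNgt le_eqVlt => /orP[/eqP/entry_inj|//].
  by lia.
split; last by have := sk k.+1; rewrite /= ok => /(_ (leqnn _)); lia.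
by split=> // i ik; apply: sk; lia.
Qed.

Lemma snake_incr_last n : snake_incr n n = gf n (snake_upto n).
Proof. by apply: eq_gf => w; split=> [[]//|sn]; split=> // i; lia. Qed.

(** For n odd the last step of a snake is an ascent, which can be counted as an
    increasing tail of length one. *)
Lemma snake_incr_odd_last n : odd n -> snake_incr n n.-1 = gf n (snake_upto n).
Proof.
case: n => // n /= on; apply: eq_gf => w; split=> [[sn inc] i|sn].
  rewrite ltnS leq_eqVlt => /orP[/eqP ->|]; last exact: sn.
  by rewrite (negPf on); apply: inc; lia.
split=> i ik; first by apply: sn; lia.
by have -> : i = n by [lia]; have := sn n; rewrite (negPf on); apply.
Qed.

(** Only the identity increases from 0: n strict steps must lead from 0 to a
    letter that is at most n. *)
Lemma snake_incr0 n : snake_incr n 0 = 1.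
Proof.
pose w1 : signed_word n := (1%g, [ffun=> false]).
have e1 k : (k <= n)%N -> entry w1 k = k%:Z.
  by case: k => // k kn; rewrite (entryE w1 (Ordinal kn)) /letter_val /= ffunE perm1.
rewrite /snake_incr /gf (big_pred1 w1) => [|w].
  rewrite /signed_inv big1 ?expr0 // => j _; rewrite /row_inv.
  rewrite big1 => [|i _]; rewrite !e1 //; have := ltn_ord j; try have := ltn_ord i; lia.
rewrite /=; apply/asboolP/eqP => [[_ inc]|->]; last first.
  by split=> i // ilt; rewrite !e1 //; lia.
have lo k : (k <= n)%N -> k%:Z <= entry w k.
  elim: k => // k IHk kn; have := inc k; have := IHk (ltnW kn); lia.
have hi k : (k <= n)%N -> entry w (n - k) <= (n - k)%:Z.
  elim: k => [|k IHk] kn; first by rewrite subn0 entry_bound.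
  have := inc (n - k.+1)%N; have -> : (n - k.+1).+1 = (n - k)%N by lia.
  by have := IHk (ltnW kn); lia.
have we (i : 'I_n) : letter_val (w.2 i, w.1 i) = i.+1.
  rewrite -entryE; have := lo i.+1 (ltn_ord i); have := hi (n - i.+1)%N (leq_subr _ _).
  by rewrite subKn //; lia.
case: w {inc lo hi} we => s e we; congr (_, _).
  apply/permP => i; rewrite perm1; apply/val_inj; have := we i.
  by rewrite /letter_val /=; case: (e i); lia.
by apply/ffunP => i; rewrite ffunE; have := we i; rewrite /letter_val /=; case: (e i); lia.
Qed.

(** Both sides pick up the same factors [2k+2]_q ... [2n]_q when k letters are
    extended to n. *)
Lemma gf_snake_extend n k : (k <= n)%N ->
  gf n (snake_upto k) * gf k (fun=> True) = gf k (snake_upto k) * gf n (fun=> True).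
Proof.
move=> kn; rewrite -(subnK kn); elim: (n - k)%N => [|d IHd]; first by rewrite mulrC.
rewrite addSn !gf_append; [|by []|].
  by rewrite -mulrA IHd mulrCA.
by move=> f g h ho gf; apply: (snake_odd_increasing ho) => i ik; apply: gf; lia.
Qed.
End GeneratingFunctions.

(** * Comparison with permutations of the letters *)

Definition word_perm_fun n (w : signed_word n) (x : letter n) : letter n :=
  (x.1 (+) w.2 x.2, w.1 x.2).

Lemma word_perm_fun_inj n (w : signed_word n) : injective (word_perm_fun w).
Proof.
move=> [s i] [t j] [] /= + /perm_inj ij; rewrite ij => /(congr1 (addb^~ (w.2 j))).
by rewrite !addbK => ->.
Qed.

Definition word_perm n (w : signed_word n) : {perm letter n} :=
  perm (@word_perm_fun_inj n w).

Lemma window_word_perm n (w : signed_word n) (i : 'I_n) :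
  window (word_perm w) i = entry w i.+1.
Proof. by rewrite entryE /window permE. Qed.

Lemma word_perm_inj n : injective (@word_perm n).
Proof.
move=> [s e] [s' e'] /permP E; congr (_, _).
  by apply/permP => i; have := E (false, i); rewrite !permE => -[].
by apply/ffunP => i; have := E (false, i); rewrite !permE => -[].
Qed.

(** The values of u at the positive letters determine it, and their absolute
    values are distinct: u takes opposite values only at opposite letters. *)
Lemma signed_permsE n : signed_perms n = [set word_perm w | w : signed_word n].
Proof.
apply/setP => u; rewrite inE; apply/forallP/imsetP => [uN|[w _ ->] [s i]]; last first.
  by rewrite !permE /letter_opp /word_perm_fun /= addNb.
have s_inj : injective (fun i : 'I_n => (u (false, i)).2).
  move=> i j; case: (boolP ((u (false, i)).1 == (u (false, j)).1)) => [/eqP|] E1 E2.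
    have /perm_inj[//] : u (false, i) = u (false, j).
    by rewrite [LHS]surjective_pairing E1 E2 -surjective_pairing.
  have : u (false, i) = u (letter_opp (false, j)).
    rewrite (eqP (uN _)) [LHS]surjective_pairing E2; congr (_, _).
    by move: E1; case: (u _).1; case: (u _).1.
  by move/perm_inj.
exists (perm s_inj, [ffun i => (u (false, i)).1]) => //.
apply/permP => -[s i]; rewrite permE /word_perm_fun /= ffunE permE.
case: s => /=; last by rewrite -surjective_pairing.
by have /eqP := uN (false, i); rewrite /letter_opp /= => ->.
Qed.

Lemma card_increasing_pairs n (A : nat -> nat -> bool) :
  #|[set p : 'I_n * 'I_n | (p.1 < p.2)%N && A p.1 p.2]|
  = (\sum_(j < n) \sum_(i < j) A i j)%N.
Proof.
rewrite -sum1_card big_mkcond /=.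
under eq_bigr do rewrite inE.
rewrite -(pair_bigA _ (fun i j : 'I_n => if (i < j)%N && A i j then 1 else 0)%N) /=.
rewrite exchange_big; apply: eq_bigr => j _ /=.
rewrite (big_ord_widen n (fun i => nat_of_bool (A i j))); last exact: ltnW.
rewrite [RHS]big_mkcond; apply: eq_bigr => i _.
by case: ifP => [/andP[-> ->]|] //; case: (i < j)%N => //=; case: (A _ _).
Qed.

Lemma invB_word_perm n (w : signed_word n) :
  invB (word_perm w) = signed_inv n (entry w).
Proof.
pose f := entry w; rewrite /invB /signed_inv /row_inv.
have -> : #|[set i | (window (word_perm w) i < 0)%R]| = (\sum_(j < n) (f j.+1 < 0)%R)%N.
  rewrite -sum1_card big_mkcond; apply: eq_bigr => j _.
  by rewrite inE window_word_perm; case: ifP.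
rewrite big_split; congr (_ + _)%N.
under [RHS]eq_bigr do rewrite big_split.
rewrite big_split; congr (_ + _)%N.
  rewrite -(card_increasing_pairs n (fun i j => f j.+1 < f i.+1)).
  by apply: eq_card => p; rewrite !inE !window_word_perm.
rewrite -(card_increasing_pairs n (fun i j => f j.+1 < - f i.+1)).
by apply: eq_card => p; rewrite !inE !window_word_perm.
Qed.

Lemma snake_word_perm n (w : signed_word n) :
  snake (word_perm w) = `[< snake_upto n (entry w) >].
Proof.
apply/andP/asboolP => [[/forallP s0 /forallP s1] [|i] ik|sn]; last split.
- by have := s0 (Ordinal ik); rewrite window_word_perm /=.
- have /forallP/(_ (Ordinal ik)) := s1 (Ordinal (ltnW ik)).
  by rewrite !window_word_perm /= eqxx /=; case: (odd i).
- apply/forallP => i; apply/implyP => /eqP i0; rewrite window_word_perm.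
  by have := sn i (ltn_ord i); rewrite i0 /=.
apply/forallP => i; apply/forallP => j; apply/implyP => /eqP ji.
rewrite !window_word_perm ji; have := sn i.+1; rewrite -ji => /(_ (ltn_ord j)).
by rewrite ji /=; case: (odd i).
Qed.

(** * Sine and cosine parts of the snake series *)

Section SineCosine.
Variables (K : fieldType) (q : K).

Lemma BpolyE n : Bpoly q n = gf q n (fun=> True).
Proof.
rewrite /Bpoly signed_permsE big_imset => [|w w' _ _]; last exact: word_perm_inj.
apply: eq_big => [w|w _]; last by rewrite invB_word_perm.
by rewrite inE; symmetry; apply/asboolP.
Qed.

Lemma SpolyE n : Spoly q n = gf q n (snake_upto n).
Proof.
rewrite /Spoly big_mkcondr signed_permsE big_imset => [|w w' _ _]; last exact: word_perm_inj.
rewrite /gf [RHS]big_mkcond; apply: eq_big => [w|w _ /=]; first by rewrite inE.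
by rewrite snake_word_perm invB_word_perm.
Qed.

Lemma BpolyS n : Bpoly q n.+1 = qint q n.+1.*2 * Bpoly q n.
Proof. by rewrite !BpolyE gf_append. Qed.

Lemma Bpoly0 : Bpoly q 0 = 1.
Proof.
rewrite BpolyE -(snake_incr0 q 0) snake_incr_last; apply: eq_gf => w.
by split.
Qed.

Hypothesis qint_neq0 : forall j, (0 < j)%N -> qint q j != 0.

Lemma Bpoly_neq0 n : Bpoly q n != 0.
Proof.
elim: n => [|n IHn]; first by rewrite Bpoly0 oner_neq0.
by rewrite BpolyS mulf_neq0 ?qint_neq0.
Qed.

Lemma qfact_neq0 n : qfact q n != 0.
Proof.
rewrite /qfact big_nat; apply: (big_ind (fun x => x != 0)) => [|x y|j /andP[j0 _]].
- exact: oner_neq0.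
- exact: mulf_neq0.
exact: qint_neq0.
Qed.

(** Up to the factor B_n, a product term of the two series is E(n,k), which is
    rewritten here by the splitting that makes the sum over k telescope. *)
Lemma Spoly_odd_term n k : odd k -> (k < n)%N ->
  Spoly q k / Bpoly q k * (qfact q (n - k))^-1
  = (snake_incr q n k.-1 + snake_incr q n k.+1) / Bpoly q n.
Proof.
move=> ok kn; rewrite -gf_snake_split //.
have E := gf_snake_extend q (ltnW kn); rewrite -!BpolyE -SpolyE in E.
rewrite (gf_incr_on q (@snake_prefix k) (ltnW kn)) in E.
have := qfact_neq0 (n - k); have := Bpoly_neq0 n; have := Bpoly_neq0 k.
move: E; move: (gf _ _ _) (Spoly q k) (Bpoly q k) (Bpoly q n) (qfact _ _).
move=> F S Bk Bn f E Bk0 Bn0 f0.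
apply: (mulIf Bk0); apply: (mulIf Bn0); apply: (mulIf f0).
transitivity (S * Bn); first by field; rewrite Bk0 f0.
by rewrite -E; field.
Qed.

Lemma sum_odd (V : nmodType) (a : nat -> V) n :
  \sum_(k < n) (if odd k then a k else 0) = \sum_(l < n./2) a l.*2.+1.
Proof.
elim: n => [|n IHn]; first by rewrite !big_ord0.
rewrite big_ord_recr /= IHn uphalf_half; case: ifP => on; last by rewrite addr0.
by rewrite add1n big_ord_recr /=; congr (_ + a _); rewrite -[LHS]odd_double_half on.
Qed.

Lemma sum_snake_incr n L : (L.*2 <= n)%N ->
  \sum_(l < L) (-1) ^+ l * (snake_incr q n l.*2 + snake_incr q n l.*2.+2)
  = 1 - (-1) ^+ L * snake_incr q n L.*2.
Proof.
elim: L => [|L IHL] Ln; first by rewrite big_ord0 snake_incr0 mul1r subrr.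
by rewrite big_ord_recr /= IHL ?exprS; [ring|lia].
Qed.

Definition even_part (f : fps K) : fps K :=
  FPS (fun n => if odd n then 0 else f n).
Definition odd_part (f : fps K) : fps K :=
  FPS (fun n => if odd n then f n else 0).

Definition snake_series : fps K := FPS (fun n => Spoly q n / Bpoly q n).

Lemma fpsC_mulr (f : fps K) c n : (f * fpsC c) n = f n * c.
Proof.
rewrite mulrC /= big_ord_recl /= subn0 mulrC big1 ?addr0 // => i _.
by rewrite mulr0n mul0r.
Qed.

Lemma fpsC_unit (c : K) : c != 0 -> fpsC c \is a GRing.unit.
Proof. by move=> c0; rewrite unfold_in /= /fps_unit unitfE. Qed.

Variable i : K.
Hypotheses (ii : i ^+ 2 = -1) (two_neq0 : (2 : K) != 0).

Lemma i_expn n : i ^+ n = (if odd n then i else 1) * (-1) ^+ n./2.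
Proof.
rewrite -{1}(odd_double_half n) exprD -muln2 mulnC exprM ii.
by case: (odd n); rewrite ?expr1.
Qed.

Lemma cos_ofE f : cos_of i f = FPS (fun n => if odd n then 0 else (-1) ^+ n./2 * f n).
Proof.
rewrite /cos_of; apply: (canLR (mulrK (fpsC_unit two_neq0))).
apply: fpsP => n; rewrite fpsC_mulr /= (exprNn i) -(signr_odd _ n) i_expn.
by case: (odd n); ring.
Qed.

Lemma i_neq0 : i != 0.
Proof. by rewrite -sqrf_eq0 ii oppr_eq0 oner_eq0. Qed.

Lemma sin_ofE f : sin_of i f = FPS (fun n => if odd n then (-1) ^+ n./2 * f n else 0).
Proof.
rewrite /sin_of; apply: (canLR (mulrK (fpsC_unit (mulf_neq0 two_neq0 i_neq0)))).
apply: fpsP => n; rewrite fpsC_mulr /= (exprNn i) -(signr_odd _ n) i_expn.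
by case: (odd n); ring.
Qed.

(** In degree n odd, the terms with k < n of the product telescope up to
    F(n,n-1), which cancels against the term k = n since it is equal to S_n. *)
Lemma odd_part_cos :
  odd_part snake_series * cos_of i (exp_q q) = sin_of i (exp_B q).
Proof.
rewrite cos_ofE sin_ofE; apply: fpsP => n /=; case: ifP => on; last first.
  apply: big1 => k _; case: ifP => ok; last by rewrite mul0r.
  by rewrite oddB ?on ?ok ?mulr0 // -ltnS.
transitivity (\sum_(k < n.+1) if odd k then
    Spoly q k / Bpoly q k * ((-1) ^+ (n - k)./2 * (qfact q (n - k))^-1) else 0).
  apply: eq_bigr => k _; case: ifP => ok; last by rewrite mul0r.
  by rewrite oddB ?on ?ok // -ltnS.
rewrite (sum_odd (fun k =>
  Spoly q k / Bpoly q k * ((-1) ^+ (n - k)./2 * (qfact q (n - k))^-1))).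
(* The last index l = n./2 is k = n, where the q-factorial is trivial. *)
have nE : n = n./2.*2.+1 by rewrite -[LHS]odd_double_half on.
have -> : n.+1./2 = n./2.+1 by rewrite /= uphalf_half on.
rewrite big_ord_recr /= -nE subnn /qfact big_nil invr1 !mulr1.
rewrite (eq_bigr (fun l : 'I_n./2 => (-1) ^+ n./2 / Bpoly q n *
   ((-1) ^+ l * (snake_incr q n l.*2 + snake_incr q n l.*2.+2)))) => [|l _].
  rewrite -mulr_sumr sum_snake_incr; last by lia.
  have -> : n./2.*2 = n.-1 by rewrite [in RHS]nE.
  rewrite snake_incr_odd_last // -SpolyE.
  rewrite mulrBr mulr1 -addrA [X in _ + X](_ : _ = 0) ?addr0 //.
  rewrite mulrA [_ / _ * _]mulrAC -expr2 sqrr_sign mul1r; ring.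
have ln := ltn_ord l.
rewrite mulrCA (@Spoly_odd_term n) /=; [|by rewrite odd_double|by lia].
have -> : ((n - l.*2.+1)./2 = n./2 - l)%N by lia.
rewrite -signr_odd oddB ?(ltnW ln) // signr_addb !signr_odd; ring.
Qed.

(** In degree n even, k odd forces k < n; the telescoping sum is 1 minus or plus
    F(n,n) = S_n, where the term 1 is cancelled by cos_B. *)
Lemma even_part_sin_cos :
  even_part snake_series
  = odd_part snake_series * sin_of i (exp_q q) + cos_of i (exp_B q).
Proof.
rewrite cos_ofE sin_ofE; apply: fpsP => n /=; case: ifP => on.
  rewrite addr0; symmetry; apply: big1 => k _; case: ifP => ok; last by rewrite mul0r.
  by rewrite oddB ?on ?ok ?mulr0 // -ltnS.
transitivity (\sum_(k < n.+1) (if odd k then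
    Spoly q k / Bpoly q k * ((-1) ^+ (n - k)./2 * (qfact q (n - k))^-1) else 0)
  + (-1) ^+ n./2 * (Bpoly q n)^-1); last first.
  congr (_ + _); apply: eq_bigr => k _; case: ifP => ok; last by rewrite mul0r.
  by rewrite oddB ?on ?ok // -ltnS.
rewrite (sum_odd (fun k =>
  Spoly q k / Bpoly q k * ((-1) ^+ (n - k)./2 * (qfact q (n - k))^-1))).
have nE : n./2.*2 = n by rewrite -[RHS]odd_double_half on.
have -> : n.+1./2 = n./2 by rewrite /= uphalf_half on.
rewrite (eq_bigr (fun l : 'I_n./2 => - (-1) ^+ n./2 / Bpoly q n *
   ((-1) ^+ l * (snake_incr q n l.*2 + snake_incr q n l.*2.+2)))) => [|l _].
  rewrite -mulr_sumr sum_snake_incr nE // snake_incr_last -SpolyE.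
  rewrite mulrBr mulr1 -addrA addrC -addrA mulNr [X in _ + X](_ : _ = 0) ?addr0 //.
    rewrite !mulNr opprK mulrA [_ / _ * _]mulrAC -expr2 sqrr_sign mul1r mulrC //.
  by ring.
have ln := ltn_ord l.
rewrite mulrCA (@Spoly_odd_term n) /=; [|by rewrite odd_double|by lia].
have -> : ((n - l.*2.+1)./2 = n./2 - l.+1)%N by lia.
rewrite -signr_odd oddB // signr_addb !signr_odd exprS; ring.
Qed.

Lemma snake_series_sin_cos :
  snake_series
  = (cos_of i (exp_q q) * cos_of i (exp_B q)
     + (sin_of i (exp_q q) + 1) * sin_of i (exp_B q)) / cos_of i (exp_q q).
Proof.
have cu : cos_of i (exp_q q) \is a GRing.unit.
  rewrite unfold_in /= /fps_unit cos_ofE /= mul1r /qfact big_nil invr1.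
  exact: unitr1.
apply: (canRL (mulrK cu)).
have -> : snake_series = even_part snake_series + odd_part snake_series.
  by apply: fpsP => n /=; case: ifP; rewrite ?add0r ?addr0.
rewrite even_part_sin_cos -odd_part_cos; ring.
Qed.
End SineCosine.

(** As a polynomial in q, [j]_q has constant coefficient 1. *)
Lemma qint_qvar_neq0 (C : numClosedFieldType) j :
  (0 < j)%N -> qint (qvar C) j != 0.
Proof.
case: j => // j _.
have -> : qint (qvar C) j.+1 = tofrac (\sum_(k < j.+1) 'X^k).
  rewrite (big_morph _ (@tofracD _) (@tofrac0 _)).
  by apply: eq_bigr => k _; rewrite tofracXn.
rewrite tofrac_eq0; apply/eqP => /(congr1 (coefp 0)) /eqP.
rewrite /= coef_sum big_ord_recl big1 => [|k _]; last by rewrite coefXn.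
by rewrite coefXn coef0 addr0 oner_eq0.
Qed.

Lemma imag_sqr (C : numClosedFieldType) : imag C ^+ 2 = -1.
Proof.
have E : tofrac ('i : C)%:P ^+ 2 = -1 :> {fraction {poly C}}.
  by rewrite -tofracXn -polyC_exp sqrCi polyCN tofracN tofrac1.
exact: E.
Qed.

Lemma ratfun_two_neq0 (C : numClosedFieldType) : (2 : ratfun C) != 0.
Proof.
have E : (2 : {fraction {poly C}}) != 0.
  by rewrite -tofrac1 -tofracMn tofrac_eq0 -polyC1 -polyCMn polyC_eq0 pnatr_eq0.
exact: E.
Qed.

Theorem corollary39 (C : numClosedFieldType) :
  let q : ratfun C := qvar C in
  let i : ratfun C := imag C in
  let cosq := cos_of i (exp_q q) in
  let sinq := sin_of i (exp_q q) in
  let cosB := cos_of i (exp_B q) in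
  let sinB := sin_of i (exp_B q) in
  FPS (fun n => Spoly q n / Bpoly q n)
  = (cosq * cosB + (sinq + 1) * sinB) / cosq.
Proof.
move=> q i cosq sinq cosB sinB; apply: snake_series_sin_cos.
- exact: qint_qvar_neq0.
- exact: imag_sqr.
exact: ratfun_two_neq0.
Qed.
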